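(* Every subcubic graph $G$ with $\mathrm{mad}(G) < \frac{12}{5}$ has a good coloring, i.e., a $(1,2^5)$-packing edge-coloring with colors $1,2_1,2_2,2_3,2_4,2_5$ such that for each vertex $u$ of degree exactly $2$ in $G$, if $u$ sees the color $1$, then $u$ does not see all five of the colors $2_1,2_2,2_3,2_4,2_5$.
   Context: Graphs are finite and simple. A graph is subcubic if its maximum degree is at most $3$. $\mathrm{mad}(G)$ denotes the maximum average degree, i.e., the maximum of $2|E(H)|/|V(H)|$ over all nonempty subgraphs $H$ of $G$. For distinct edges $e,f$ of $G$, the distance between $e$ and $f$ is the distance between the corresponding vertices of the line graph $L(G)$ (so edges sharing an endpoint are at distance $1$). A $(1,2^5)$-packing edge-coloring of $G$ is a partition of $E(G)$ into six classes (possibly empty), labelled by the colors $1,2_1,2_2,2_3,2_4,2_5$, such that any two distinct edges of color $1$ are at distance at least $2$ (color $1$ is a matching), and for each $i$ any two distinct edges of color $2_i$ are at distance at least $3$ (color $2_i$ is an induced matching). A vertex $u$ sees the color $1$ if some edge incident with $u$ has color $1$. A vertex $u$ sees the color $2_i$ if there is an edge $u_1u_2$ of color $2_i$ such that $u_1$ or $u_2$ is at distance at most one from $u$ in $G$. *)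

(* Defs.v *)
From mathcomp Require Import all_boot all_order all_algebra.

Set Implicit Arguments.
Unset Strict Implicit.
Unset Printing Implicit Defensive.

Section Distance.

Variables (T : finType) (r : rel T).

Definition walk_of_length (x y : T) (n : nat) : bool :=
  [exists p : n.-tuple T, path r x p && (last x p == y)].

(* The least length of a walk from [x] to [y], or [None] (infinite distance)
   if there is none. Since a shortest walk has no repeated vertex, only lengths
   smaller than [#|T|] have to be searched. *)
Definition dist (x y : T) : option nat :=
  let n := find (walk_of_length x y) (iota 0 #|T|) in
  if n < #|T| then Some n else None.

Definition dist_at_most (k : nat) (x y : T) : bool :=
  if dist x y is Some n then n <= k else false.

Definition dist_at_least (k : nat) (x y : T) : bool :=
  if dist x y is Some n then k <= n else true.

End Distance.

(* A simple graph is a symmetric irreflexive relation [adj] on a finite type;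
   its edges are the two-element sets [[set x; y]] with [adj x y]. *)
Section Graph.

Variables (V : finType) (adj : rel V).

Definition edges : {set {set V}} :=
  [set f | [exists x, exists y, adj x y && (f == [set x; y])]].

Definition degree (v : V) : nat := #|[set w | adj v w]|.

Definition max_degree : nat := \max_(v : V) degree v.

Definition subcubic : bool := max_degree <= 3.

(* A subgraph is given by its vertex set [H.1] and its edge set [H.2]. *)
Definition nonempty_subgraph (H : {set V} * {set {set V}}) : bool :=
  [&& H.1 != set0, H.2 \subset edges & [forall f in H.2, f \subset H.1]].

(* All the ratios are nonnegative, so the default value 0 of the maximum is
   only relevant for the graph without vertices. *)
Definition mad : rat :=
  (\big[Num.max/0]_(H : {set V} * {set {set V}} | nonempty_subgraph H)
     ((2 * #|H.2|)%:R / #|H.1|%:R))%R.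

(* The line graph lives on the whole type [{set V}]: sets that are not edges
   are isolated vertices, which does not affect distances between edges. *)
Definition line_adj : rel {set V} :=
  [rel f g | [&& f \in edges, g \in edges, f != g & f :&: g != set0]].

End Graph.

Notation color := (option 'I_5).
Notation color1 := (None : color).
Notation color2 i := (Some i : color).

(* A coloring is a total function on [{set V}]; only its values on edges are
   ever used. *)
Section Coloring.

Variables (V : finType) (adj : rel V) (c : {set V} -> color).

Definition packing_edge_coloring : Prop :=
  (forall f g : {set V}, f \in edges adj -> g \in edges adj -> f != g ->
     c f = color1 -> c g = color1 -> dist_at_least (line_adj adj) 2 f g)
  /\
  (forall (i : 'I_5) (f g : {set V}),
     f \in edges adj -> g \in edges adj -> f != g ->
     c f = color2 i -> c g = color2 i -> dist_at_least (line_adj adj) 3 f g).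

Definition sees_color1 (u : V) : Prop :=
  exists f : {set V}, [/\ f \in edges adj, u \in f & c f = color1].

Definition sees_color2 (u : V) (i : 'I_5) : Prop :=
  exists u1 u2 : V,
    [/\ adj u1 u2, c [set u1; u2] = color2 i
      & dist_at_most adj 1 u u1 || dist_at_most adj 1 u u2].

Definition good_coloring : Prop :=
  packing_edge_coloring /\
  (forall u : V, degree adj u = 2 -> sees_color1 u ->
     ~ (forall i : 'I_5, sees_color2 u i)).

End Coloring.

(* Main.v *)
(** A graph with no good coloring all of whose edge-deleted subgraphs have one
    has no vertex of degree 1, and a thread (two adjacent vertices u, v of
    degree 2, with further neighbours x of u and y of v) restricts x severely:
    a good coloring of G - uv extends to uv unless ux and vy carry the same
    color k of type 2 and, without ux, the vertex x sees color 1 and all four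
    colors of type 2 other than k.  This forces x to have degree 3, to have a
    neighbour of degree 3, and to be the end of no other thread.  Hence if
    every vertex of degree 3 sends charge 2 to its neighbour on a thread and
    charge 1 to its other neighbours of degree 2, then 5 deg - 12 becomes
    nonnegative at every nonisolated vertex, so the average degree of these is
    at least 12/5. *)

Require Import Defs.
From mathcomp Require Import all_boot all_order all_algebra.
From mathcomp Require Import zify.
From Stdlib Require Import Classical_Prop.

Set Implicit Arguments.
Unset Strict Implicit.
Unset Printing Implicit Defensive.

(** * Counting colors of type 2 in a list *)

Lemma missing_color (s : seq color) :
  count isSome s <= 4 -> exists i : 'I_5, color2 i \notin s.
Proof.
move=> hs; apply/existsP; apply: contraLR hs => /existsPn hall.
rewrite -ltnNge -size_filter.
have hsub : {subset map Some (enum 'I_5) <= filter isSome s}.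
  move=> _ /mapP[i _ ->]; rewrite mem_filter /=.
  by have := hall i; rewrite negbK.
have huniq : uniq (map (@Some 'I_5) (enum 'I_5)).
  by rewrite map_inj_uniq ?enum_uniq // => i j [].
by have := uniq_leq_size huniq hsub; rewrite size_map size_enum_ord.
Qed.

Lemma count_color2 (s : seq color) :
  color1 \in s -> (count isSome s).+1 <= size s.
Proof.
elim: s => [//|a s IH]; rewrite inE => /orP[/eqP <- /=|/IH h].
  by rewrite add0n ltnS count_size.
by rewrite /=; case: (isSome a) => /=; lia.
Qed.

(** An occurrence of color 1 leaves at most four entries of type 2 among five; most counts around a
    vertex take this form. *)
Lemma missing_color5 (s : seq color) :
  size s <= 5 -> color1 \in s -> exists i : 'I_5, color2 i \notin s.
Proof.
by move=> hs /count_color2 h; apply: missing_color; lia.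
Qed.

(** * Graphs, deletion of an edge, neighbour lists *)

Section Graphs.

Variable V : finType.
Implicit Types (e d : rel V) (c : V -> V -> color) (x y z u v p q : V).

(** Equality of unordered pairs. Until the translation to sets at the end, an edge is a pair of
    adjacent vertices and a coloring is a symmetric function of two vertices. *)
Definition same p q x y := (x == p) && (y == q) || (x == q) && (y == p).

Definition del e p q : rel V := [rel x y | e x y && ~~ same p q x y].

Definition near e x z := (x == z) || e x z.

Definition upd c p q (k : color) x y := if same p q x y then k else c x y.

Record graph e : Prop := Graph {
  g_sym : symmetric e;
  g_irr : irreflexive e;
  g_deg : forall v, degree e v <= 3 }.

Lemma same_sym p q x y : same p q x y = same p q y x.
Proof. by rewrite /same orbC andbC (andbC (x == p)). Qed.

Lemma same_swap p q x y : same p q x y = same q p x y.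
Proof. by rewrite /same orbC. Qed.

Lemma same_out p q x y : x != p -> x != q -> same p q x y = false.
Proof. by rewrite /same => /negPf -> /negPf ->. Qed.

Lemma same_refl p q : same p q p q.
Proof. by rewrite /same !eqxx. Qed.

Lemma upd_same c p q k : upd c p q k p q = k.
Proof. by rewrite /upd same_refl. Qed.

Lemma upd_out c p q k x y : x != p -> x != q -> upd c p q k x y = c x y.
Proof. by move=> h1 h2; rewrite /upd same_out. Qed.

Lemma upd_sym c p q k :
  (forall x y, c x y = c y x) -> forall x y, upd c p q k x y = upd c p q k y x.
Proof. by move=> hc x y; rewrite /upd same_sym hc. Qed.

Lemma del_sub e p q x y : del e p q x y -> e x y.
Proof. by case/andP. Qed.

Lemma del_out e p q x y : x != p -> x != q -> del e p q x y = e x y.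
Proof. by move=> h1 h2; rewrite /del /= same_out ?andbT. Qed.

Lemma degree_sub e d z : (forall w, d z w -> e z w) -> degree d z <= degree e z.
Proof. by move=> h; apply/subset_leq_card/subsetP => w; rewrite !inE; apply: h. Qed.

Lemma degree_del e p q z : degree (del e p q) z <= degree e z.
Proof. by apply: degree_sub => w /del_sub. Qed.

Lemma graph_del e p q : graph e -> graph (del e p q).
Proof.
move=> [hs hi hd]; split.
- by move=> x y; rewrite /del /= hs same_sym.
- by move=> x; rewrite /del /= hi.
- by move=> v; apply: leq_trans (degree_del e p q v) (hd v).
Qed.

Lemma graph_neq e x y : graph e -> e x y -> x != y.
Proof. by move=> ge; apply: contraTneq => ->; rewrite g_irr. Qed.

(* The list is padded with repeated neighbours, so that no case distinction on
   the exact degree is needed. *)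
Lemma neighbours e x n (t : seq V) :
  degree e x <= n -> t != [::] -> uniq t -> {subset t <= e x} ->
  exists2 s, size s = n - size t & forall z, e x z = (z \in t ++ s).
Proof.
move=> hd; case: t => [//|a t] _ hu hsub.
set N := enum [set w | e x w].
have hN z : (z \in N) = e x z by rewrite mem_enum inE.
pose r := [seq w <- N | w \notin a :: t].
have hr : size r + size (a :: t) = size N.
  have hp : perm_eq [seq w <- N | w \in a :: t] (a :: t).
    apply: uniq_perm => //; first by rewrite filter_uniq ?enum_uniq.
    move=> w; rewrite mem_filter hN andb_idr //.
    exact: hsub.
  by rewrite -(perm_size hp) /r size_filter [size [seq _ <- _ | _]]size_filter
    addnC -(count_predC (mem (a :: t)) N).
have hNd : size N = degree e x by rewrite /N -cardE.
exists (r ++ nseq (n - size (a :: t) - size r) a).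
  by rewrite size_cat size_nseq subnKC // -(addnK (size (a :: t)) (size r)) hr hNd leq_sub2r.
move=> z; rewrite !mem_cat mem_nseq mem_filter hN.
have [hz|hz] := boolP (z \in a :: t); first exact: hsub.
have za : (z == a) = false by apply: contraNF hz => /eqP->; rewrite mem_head.
by rewrite /= za andbF orbF.
Qed.

Lemma neighbours1 e x a : degree e x <= 1 -> e x a ->
  forall z, e x z = (z == a).
Proof.
move=> hd ha; have [] := @neighbours e x 1 [:: a] hd => //.
  by move=> w; rewrite inE => /eqP->.
by move=> [|//] _ h z; rewrite h !inE.
Qed.

Lemma neighbours2 e x a : degree e x <= 2 -> e x a ->
  exists b, forall z, e x z = (z == a) || (z == b).
Proof.
move=> hd ha; have [] := @neighbours e x 2 [:: a] hd => //.
  by move=> w; rewrite inE => /eqP->.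
by move=> [//|b [|//]] _ h; exists b => z; rewrite h !inE.
Qed.

Lemma neighbours2_full e x a b : degree e x <= 2 -> e x a -> e x b -> a != b ->
  forall z, e x z = (z == a) || (z == b).
Proof.
move=> hd ha hb hab; have [] := @neighbours e x 2 [:: a; b] hd => //.
- by rewrite /= inE hab.
- by move=> w; rewrite !inE => /orP[] /eqP->.
- by move=> [|//] _ h z; rewrite h !inE.
Qed.

Lemma neighbours3 e x a : graph e -> e x a ->
  exists b b', forall z, e x z = [|| z == a, z == b | z == b'].
Proof.
move=> ge ha; have [] := @neighbours e x 3 [:: a] (g_deg ge x) => //.
  by move=> w; rewrite inE => /eqP->.
by move=> [//|b [//|b' [|//]]] _ h; exists b, b' => z; rewrite h !inE.
Qed.

Lemma neighbours3_pair e x a b : graph e -> e x a -> e x b -> a != b ->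
  exists b', forall z, e x z = [|| z == a, z == b | z == b'].
Proof.
move=> ge ha hb hab; have [] := @neighbours e x 3 [:: a; b] (g_deg ge x) => //.
- by rewrite /= inE hab.
- by move=> w; rewrite !inE => /orP[] /eqP->.
- by move=> [//|b' [|//]] _ h; exists b' => z; rewrite h !inE.
Qed.

Lemma neighbours3_full e x a b b' : graph e -> e x a -> e x b -> e x b' ->
  a != b -> a != b' -> b != b' ->
  forall z, e x z = [|| z == a, z == b | z == b'].
Proof.
move=> ge ha hb hb' n1 n2 n3.
have [] := @neighbours e x 3 [:: a; b; b'] (g_deg ge x) => //.
- by rewrite /= !inE negb_or n1 n2 n3.
- by move=> w; rewrite !inE => /or3P[] /eqP->.
- by move=> [|//] _ h z; rewrite h !inE.
Qed.

(** * Good colorings and niceness at a vertex *)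

(* The edges of [d] are properly colored with respect to the distances in the
   possibly larger graph [e]; conflicts at distance 1 and 2 in the line graph
   are both captured by [near]. *)
Definition proper d e c : Prop :=
  (forall x y z, d x y -> d x z -> c x y = color1 -> c x z = color1 -> y = z) /\
  (forall i x y z w, d x y -> d z w -> near e x z ->
     c x y = color2 i -> c z w = color2 i -> same x y z w).

Definition misses e c u (i : 'I_5) :=
  [forall a, forall b, near e u a && e a b ==> (c a b != color2 i)].

Definition sees1 e c u := [exists a, e u a && (c u a == color1)].

(* Imposed on all vertices of degree at most 2, not exactly 2: it is automatic
   in degree at most 1. *)
Definition nice e c u :=
  (degree e u <= 2) && sees1 e c u ==> [exists i, misses e c u i].

Record good e c : Prop := Good {
  good_sym : forall x y, c x y = c y x;
  good_proper : proper e e c;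
  good_nice : forall z, nice e c z }.

Definition colorable e := exists c, good e c.

(** When [k] may be put on [p q]: the edges already colored are those of [d], while distances are
    measured in [e]. *)
Definition free d e c p q (k : color) : Prop :=
  if k is Some i then
    forall x y, near e p x || near e q x -> d x y -> c x y <> color2 i
  else (forall y, d p y -> c p y <> color1) /\ (forall y, d q y -> c q y <> color1).

Lemma missesP e c u i :
  reflect (forall a b, near e u a -> e a b -> c a b <> color2 i)
          (misses e c u i).
Proof.
apply: (iffP forallP) => [h a b h1 h2 | h a].
  by have /forallP/(_ b) := h a; rewrite h1 h2 => /eqP.
by apply/forallP => b; apply/implyP => /andP[h1 h2]; apply/eqP/h.
Qed.

Lemma sees1P e c u :
  reflect (exists2 a, e u a & c u a = color1) (sees1 e c u).
Proof.
apply: (iffP existsP) => [[a /andP[h /eqP]]|[a h1 h2]]; first by exists a.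
by exists a; rewrite h1 h2.
Qed.

Lemma sees1_in e c u (s : seq V) :
  (forall z, e u z -> z \in s) -> sees1 e c u -> color1 \in map (c u) s.
Proof. by move=> h /sees1P[a ha <-]; apply/map_f/h. Qed.

Lemma near_sym e x y : graph e -> near e x y = near e y x.
Proof. by move=> ge; rewrite /near eq_sym (g_sym ge). Qed.

(** Four type 2 entries leave a fifth color to miss. Since [s] may also contain color 1, it can
    simply list the colors of the edges around [u]. *)
Lemma nice_list e c u (s : seq color) :
  (degree e u <= 2 -> sees1 e c u -> count isSome s <= 4 /\
    forall a b, near e u a -> e a b -> c a b != None -> c a b \in s) ->
  nice e c u.
Proof.
move=> h; apply/implyP => /andP[hd hs]; have [h1 h2] := h hd hs.
have [i hi] := missing_color h1; apply/existsP; exists i.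
apply/missesP => a b na ab E; move: (h2 a b na ab).
by rewrite E (negPf hi) => /(_ isT).
Qed.

(** Transfer to a vertex that a change hardly touches: if [z] gains no incident color 1 and sees no
    new color of type 2 when passing from [d], [c'] to [e], [c], then a color missed before is still
    missed. *)
Lemma nice_ext e d c c' z :
  (degree e z <= 2 -> degree d z <= 2) ->
  (forall b, e z b -> c z b = None -> d z b /\ c' z b = None) ->
  (forall a b i, near e z a -> e a b -> c a b = Some i ->
     [/\ near d z a, d a b & c' a b = Some i]) ->
  nice d c' z -> nice e c z.
Proof.
move=> hd h1 hf /implyP hn; apply/implyP => /andP[de /sees1P[b eb cb]].
have [db cb'] := h1 b eb cb.
have /existsP[i /missesP hi] : [exists i, misses d c' z i].
  by apply: hn; rewrite hd //=; apply/sees1P; exists b.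
apply/existsP; exists i; apply/missesP => a w na aw E.
by have [n2 d2 /hi] := hf a w i na aw E; apply.
Qed.

Lemma nice_leaf e c z : graph e -> (forall x y, c x y = c y x) ->
  degree e z <= 1 -> nice e c z.
Proof.
move=> ge cs hd; apply/implyP => /andP[_ /sees1P[a za ca]].
have hz := neighbours1 hd za.
have [b [b' ha]] := neighbours3 ge (etrans (g_sym ge a z) za).
have [//||i hi] := @missing_color5 [:: c z a; c a b; c a b'].
  by rewrite ca.
apply/existsP; exists i; apply/missesP => p q np pq E.
move: hi; rewrite -E; move: np pq.
rewrite /near hz => /orP[/eqP<-|/eqP->]; rewrite ?hz ?ha.
  by move=> /eqP->; rewrite !inE eqxx.
by move=> /or3P[] /eqP->; rewrite !inE ?(cs a z) eqxx ?orbT.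
Qed.

(** At most five edges lie around [z]: two at [z], one more at [a], two more at the other neighbour;
    and one of those at [z] has color 1. So niceness can fail only at a vertex of degree 2 with both
    neighbours of degree 3. *)
Lemma nice_nbr e c z a : graph e -> (forall x y, c x y = c y x) ->
  e z a -> degree e a <= 2 -> nice e c z.
Proof.
move=> ge cs za da; apply/implyP => /andP[dz hs].
have [b hz] := neighbours2 dz za.
have zb : e z b by rewrite hz eqxx orbT.
have [a' ha] := neighbours2 da (etrans (g_sym ge a z) za).
have [b1 [b2 hb]] := neighbours3 ge (etrans (g_sym ge b z) zb).
have [//||i hi] := @missing_color5 [:: c z a; c z b; c a a'; c b b1; c b b2].
  have /= := @sees1_in e c z [:: a; b] _ hs; rewrite !inE => hin.
  have : [|| None == c z a | None == c z b].
    by apply: hin => w; rewrite hz !inE.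
  by case/orP => ->; rewrite ?orbT.
apply/existsP; exists i; apply/missesP => p q np pq E.
move: hi; rewrite -E; move: np pq.
rewrite /near hz => /or3P[/eqP<-|/eqP->|/eqP->]; rewrite ?hz ?ha ?hb.
- by move=> /orP[] /eqP->; rewrite !inE eqxx ?orbT.
- by move=> /orP[] /eqP->; rewrite !inE ?(cs a z) eqxx ?orbT.
- by move=> /or3P[] /eqP->; rewrite !inE ?(cs b z) eqxx ?orbT.
Qed.

(** * Recoloring or deleting a single edge *)

Lemma proper_upd e c p q k : graph e -> (forall x y, c x y = c y x) ->
  proper (del e p q) e c -> free (del e p q) e c p q k ->
  proper e e (upd c p q k).
Proof.
move=> ge cs [hm hf] hk.
have delE x y : e x y -> ~~ same p q x y -> del e p q x y.
  by move=> h1 h2; rewrite /del /= h1.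
split.
- move=> x y z xy xz; rewrite /upd.
  case: ifPn => s1; case: ifPn => s2.
  + move: s1 s2; rewrite /same.
    case/orP=> /andP[/eqP-> /eqP->]; rewrite eqxx /=.
      by case/orP=> [/eqP->//|/andP[/eqP-> /eqP->]].
    case/orP=> [/andP[/eqP E /eqP->]|/eqP->//]; first by rewrite E.
  + move=> E cz; move: hk; rewrite E /= => -[h1 h2].
    case/orP: s1 => /andP[/eqP ex _]; subst x.
      by case: (h1 z) => //; apply: delE.
    by case: (h2 z) => //; apply: delE.
  + move=> cy E; move: hk; rewrite E /= => -[h1 h2].
    case/orP: s2 => /andP[/eqP ex _]; subst x.
      by case: (h1 y) => //; apply: delE.
    by case: (h2 y) => //; apply: delE.
  + by apply: hm; apply: delE.
- move=> i x y z w xy zw n; rewrite /upd.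
  case: ifPn => s1; case: ifPn => s2.
  + move=> _ _; move: s1 s2; rewrite /same.
    by case/orP=> /andP[/eqP-> /eqP->]; case/orP=> /andP[/eqP-> /eqP->];
      rewrite !eqxx ?orbT.
  + move=> E cz; move: hk; rewrite E /= => /(_ z w); case => //; last exact: delE.
    by case/orP: s1 => /andP[/eqP ex _]; subst x; rewrite n ?orbT.
  + move=> cz E; move: hk; rewrite E /= => /(_ x y); case => //; last exact: delE.
    by rewrite near_sym // in n; case/orP: s2 => /andP[/eqP ex _]; subst z; rewrite n ?orbT.
  + by apply: hf => //; apply: delE.
Qed.

Lemma proper_sub d d' e c : (forall x y, d' x y -> d x y) ->
  proper d e c -> proper d' e c.
Proof.
move=> h [hm hf]; split=> [x y z /h h1 /h h2|i x y z w /h h1 /h h2].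
  exact: hm.
exact: hf.
Qed.

Lemma proper_near d e e' c :
  (forall i x y z w, d x y -> d z w -> c x y = color2 i -> c z w = color2 i ->
     near e' x z -> near e x z) ->
  proper d e c -> proper d e' c.
Proof.
move=> h [hm hf]; split=> // i x y z w xy zw n cx cz.
by apply: (hf i) => //; apply: (h i x y z w).
Qed.

Lemma nice_upd_far e c p q k z : graph e ->
  ~~ near e p z -> ~~ near e q z -> nice e c z -> nice e (upd c p q k) z.
Proof.
move=> ge np nq; apply: nice_ext => //.
- by move=> b zb; rewrite upd_out //; [apply: contraNneq np | apply: contraNneq nq];
    move=> ->; rewrite /near eqxx.
- move=> a b i na ab; rewrite upd_out //.
  + by apply: contraNneq np => <-; rewrite near_sym.
  + by apply: contraNneq nq => <-; rewrite near_sym.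
Qed.

(** The edge turned to color 1 is not incident with [z], so the change can only remove a type 2
    color from what [z] sees. *)
Lemma nice_upd1 e c p q z : z != p -> z != q ->
  nice e c z -> nice e (upd c p q None) z.
Proof.
move=> np nq; apply: nice_ext => //.
- by move=> b zb; rewrite upd_out.
- by move=> a b i na ab; rewrite /upd; case: ifP.
Qed.

Lemma nice_del e c p q z : z != p -> z != q ->
  nice e c z -> nice (del e p q) c z.
Proof.
move=> np nq; apply: nice_ext.
- by apply/leq_trans/degree_sub => w zw; rewrite del_out.
- by move=> b /del_sub.
- move=> a b i na /del_sub ab; split=> //.
  by case/orP: na => [/eqP->|/del_sub h]; rewrite /near ?eqxx // h orbT.
Qed.

(** Deletion lowers degrees only at [p] and [q], so only there may the niceness condition start to
    apply. *)
Lemma good_del e c p q : nice (del e p q) c p -> nice (del e p q) c q ->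
  good e c -> good (del e p q) c.
Proof.
move=> np nq [cs hp hn]; split=> //.
  apply: (@proper_near _ e).
    move=> i x y z w _ _ _ _; rewrite /near => /orP[->//|/del_sub ->].
    by rewrite orbT.
  by apply: proper_sub hp => x y /del_sub.
move=> z; have [->//|zp] := eqVneq z p; have [->//|zq] := eqVneq z q.
exact: nice_del.
Qed.

Lemma recolor1 e c p q : graph e -> good e c ->
  (forall c', (forall x y, c' x y = c' y x) -> nice e c' p) ->
  (forall c', (forall x y, c' x y = c' y x) -> nice e c' q) ->
  (forall y, e p y -> y != q -> c p y <> color1) ->
  (forall y, e q y -> y != p -> c q y <> color1) ->
  good e (upd c p q None).
Proof.
move=> ge [cs hp hn] np nq fp fq; split.
- exact: upd_sym.
- apply: proper_upd => //; first by apply: proper_sub hp => x y /del_sub.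
  split=> y /andP[h1 h2]; [apply: fp|apply: fq] => //;
    by apply: contraNneq h2 => ->; rewrite ?same_refl // same_swap same_refl.
- move=> z; have [->|zp] := eqVneq z p; first by apply: np; apply: upd_sym.
  have [->|zq] := eqVneq z q; first by apply: nq; apply: upd_sym.
  exact: nice_upd1.
Qed.

Lemma nice_near e c p z : graph e -> (forall x y, c x y = c y x) ->
  degree e p <= 2 -> nice e c p -> near e p z -> nice e c z.
Proof.
move=> ge cs dp np /orP[/eqP <-//|]; rewrite (g_sym ge) => zp.
exact: nice_nbr zp dp.
Qed.

(** By [nice_nbr], all vertices within distance 1 of the two ends are nice in any symmetric
    coloring; the other vertices do not see the edge [p q]. *)
Lemma recolor2 e c p q m : graph e -> good e c -> e p q ->
  degree e p <= 2 -> degree e q <= 2 ->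
  free (del e p q) e c p q (Some m) -> good e (upd c p q (Some m)).
Proof.
move=> ge [cs hp hn] pq dp dq hf; split.
- exact: upd_sym.
- by apply: proper_upd => //; apply: proper_sub hp => x y /del_sub.
- have us := upd_sym p q (Some m) cs.
  have np : nice e (upd c p q (Some m)) p by apply: nice_nbr pq dq.
  have nq : nice e (upd c p q (Some m)) q.
    by apply: nice_nbr dp => //; rewrite (g_sym ge).
  move=> z.
  have [h|h1] := boolP (near e p z); first exact: nice_near h.
  have [h|h2] := boolP (near e q z); first exact: nice_near h.
  exact: nice_upd_far.
Qed.

(** * Reducible configurations *)

(** No other edge ends at [u], so restoring [u x] shortens no distance between the remaining
    edges. *)
Lemma proper_pendant e u x c : graph e -> e u x -> degree e u <= 1 ->
  proper (del e u x) (del e u x) c -> proper (del e u x) e c.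
Proof.
move=> ge ux du; have hu := neighbours1 du ux.
have nu y : del e u x u y = false.
  by rewrite /del /= hu; have [->|//] := eqVneq y x; rewrite same_refl.
apply: proper_near => i a b a' b' ab ab' _ _.
rewrite /near; have [//|_ /= h] := eqVneq a a'.
rewrite /del /= h; apply: contraT; rewrite negbK /same => /orP[] /andP[/eqP E1 /eqP E2].
  by rewrite E1 nu in ab.
by rewrite E2 nu in ab'.
Qed.

(* Coloring [u x] with [i] can only spoil a neighbour [w] of [x] with
   [c w x = color1]; in that case [w x] takes [i] and [u x] takes color 1. *)
Lemma pendant e u x c i : graph e -> e u x -> degree e u <= 1 ->
  good (del e u x) c -> sees1 (del e u x) c x -> misses (del e u x) c x i ->
  exists c', [/\ good e c', c' u x = None \/ c' u x = Some i &
    forall p q, p != x -> q != x -> c' p q = c p q].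
Proof.
move=> ge ux du [cs hp hn] sx /missesP mi.
set H := del e u x in hp hn sx mi.
have gH : graph H by apply: graph_del.
have hu := neighbours1 du ux.
have xu : e x u by rewrite (g_sym ge).
have nux : u != x := graph_neq ge ux.
have nu y : H u y = false.
  by rewrite /H /del /= hu; have [->|//] := eqVneq y x; rewrite same_refl.
have Hx z : H x z = e x z && (z != u).
  by rewrite /H /del /= /same eqxx [x == u]eq_sym (negPf nux).
have pe : proper H e c by apply: proper_pendant.
set c1 := upd c u x (Some i).
have c1s : forall x y, c1 x y = c1 y x by apply: upd_sym.
have p1 : proper e e c1.
  apply: proper_upd => // a b nab ab.
  have au : a != u by apply: contraTneq ab => ->; rewrite -/H nu.
  apply: (mi a b) => //; move: nab; rewrite /near hu [u == a]eq_sym (negPf au) Hx au andbT.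
  by case/orP=> [/eqP->|//]; rewrite eqxx.
have [/forallP hall|] := boolP [forall z, nice e c1 z].
  exists c1; split=> //; first by right; rewrite /c1 upd_same.
  by move=> p q np nq; rewrite /c1 /upd /same (negPf np) (negPf nq) andbF.
(* A spoiled vertex [w] is neither [u] nor [x], and it must be a neighbour of [x] to notice the new
   color. *)
rewrite negb_forall => /existsP[w hw].
have wu : w != u by apply: contraNneq hw => ->; apply: nice_leaf.
have wx : w != x.
  by apply: contraNneq hw => ->; apply: nice_nbr xu _ => //; apply: leq_trans du _.
have nwu : e w u = false by rewrite (g_sym ge) hu (negPf wx).
have c1w y : c1 w y = c w y by rewrite /c1 upd_out.
have xw : e x w.
  apply: contraNT hw => nxw; apply: (nice_ext _ _ _ (hn w)).
  - by apply/leq_trans/degree_del.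
  - by move=> b wb; rewrite c1w /H del_out.
  - move=> a b j; rewrite /near /H del_out // => na ab.
    have ax : a != x.
      apply: contraTneq na => ->.
      by rewrite negb_or wx (g_sym ge).
    have au : a != u by apply: contraTneq na => ->; rewrite negb_or wu nwu.
    by rewrite /c1 upd_out // del_out.
have wx' : e w x by rewrite (g_sym ge).
have key s : count isSome s <= 4 ->
    (forall a b, near e w a -> e a b -> c1 a b != None -> c1 a b \in s) -> False.
  by move=> h1 h2; move/negP: hw; apply; apply: (nice_list (s := s)).
move: (hw); rewrite negb_imply => /andP[/andP[dw sw] _].
have [a' hw2] := neighbours2 dw wx'.
have wa' : e w a' by rewrite hw2 eqxx orbT.
have a'w : e a' w by rewrite (g_sym ge).
have a'u : a' != u by apply: contraTneq wa' => ->; rewrite nwu.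
have c1xu : c1 x u = Some i by rewrite c1s /c1 upd_same.
(* Otherwise color 1 is on a third edge at [x] and on [w a'], which leaves at most four edges around
   [w] for type 2. *)
have cwx : c w x = None.
  apply/eqP/negP => /negP cwx.
  have [b xb cb] := sees1P _ _ _ sx; move: xb; rewrite Hx => /andP[xb bu].
  have bw : w != b by apply: contraNneq cwx => ->; rewrite cs cb.
  have cwa' : c1 w a' = None.
    have [t wt ct] := sees1P _ _ _ sw; move: wt; rewrite hw2.
    case/orP=> /eqP E; last by rewrite -E.
    by move: ct; rewrite E c1w => E'; rewrite E' in cwx.
  have uw : u != w by rewrite eq_sym.
  have ub : u != b by rewrite eq_sym.
  have hx := neighbours3_full ge xu xw xb uw ub bw.
  have [p [q ha']] := neighbours3 ge a'w.
  have c1xb : c1 x b = None.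
    by rewrite /c1 /upd /same eqxx (negPf bu) [x == u]eq_sym (negPf nux).
  apply: (key [:: c1 x u; c1 x w; c1 a' p; c1 a' q]); first exact: count_size.
  move=> y z; rewrite /near hw2 => /or3P[/eqP<-|/eqP->|/eqP->].
  - rewrite hw2 => /orP[] /eqP->; rewrite ?cwa' // c1s !inE eqxx ?orbT //.
  - by rewrite hx => /or3P[] /eqP->; rewrite ?c1xb // !inE eqxx ?orbT.
  - by rewrite ha' => /or3P[] /eqP->; rewrite 1?[c1 a' w]c1s ?cwa' // !inE eqxx ?orbT.
have uw : u != w by rewrite eq_sym.
have [b hx] := neighbours3_pair ge xu xw uw.
(* Now [w x] has color 1, and a second occurrence of [i] around [w] would again leave at most four
   type 2 colors there. Hence [i] is available for [w x]. *)
have far_a' t : a' != x -> e a' t -> t != w -> c a' t <> Some i.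
  move=> a'x a't tw E; have wt : w != t by rewrite eq_sym.
  have [q ha'] := neighbours3_pair ge a'w a't wt.
  apply: (key [:: Some i; c1 x b; c1 w a'; c1 a' q]); first exact: count_size.
  move=> y z; rewrite /near hw2 => /or3P[/eqP<-|/eqP->|/eqP->].
  - by rewrite hw2 => /orP[] /eqP->; rewrite ?c1w ?cwx // !inE eqxx ?orbT.
  - rewrite hx => /or3P[] /eqP->; rewrite ?c1xu 1?[c1 x w]c1s ?c1w ?cwx // !inE eqxx ?orbT //.
  - rewrite ha' => /or3P[] /eqP->; rewrite 1?[c1 a' w]c1s.
    + by rewrite !inE eqxx ?orbT.
    + by rewrite /c1 upd_out // E !inE eqxx.
    + by rewrite !inE eqxx ?orbT.
have Hxw : H x w by rewrite Hx xw.
have Hwx : H w x by rewrite (g_sym gH).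
pose c3 := upd c w x (Some i).
have c3s : forall x y, c3 x y = c3 y x by apply: upd_sym.
have p3 : proper H H c3.
  apply: proper_upd => //; first by apply: proper_sub hp => y z /del_sub.
  move=> y z nyz /andP[yz nsame].
  have [h|nxy] := boolP (near H x y); first exact: mi h yz.
  move: nyz; rewrite (negPf nxy) orbF => nwy.
  have [E|yw] := eqVneq y w; first by rewrite E /near Hxw orbT in nxy.
  have E : y = a'.
    move: nwy; rewrite /near [w == y]eq_sym (negPf yw) /= => /del_sub.
    rewrite hw2 => /orP[/eqP E|/eqP//].
    by rewrite E /near eqxx in nxy.
  subst y.
  have [->|zw] := eqVneq z w.
    by rewrite cs; apply: mi; [rewrite /near Hxw orbT | rewrite /H del_out].
  apply: far_a' => //; last exact: del_sub yz.
  by apply: contraNneq nxy => ->; rewrite /near eqxx.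
(* Color 1 moves from [w x] to [u x]; being a matching, it is on no other edge at [x]. *)
pose c2 := upd c3 u x None.
have c2s : forall x y, c2 x y = c2 y x by apply: upd_sym.
have c2out y z : y != u -> y != x -> y != w -> c2 y z = c y z.
  by move=> *; rewrite /c2 /c3 !upd_out.
have c2wx : c2 w x = Some i by rewrite /c2 upd_out // /c3 upd_same.
have c2xu : c2 x u = None by rewrite c2s /c2 upd_same.
have [hm _] := hp.
have p2 : proper e e c2.
  apply: proper_upd => //; first exact: proper_pendant.
  split=> y; rewrite -/H ?nu // => xy.
  have [->|yw] := eqVneq y w; first by rewrite c3s /c3 upd_same.
  have [E|xw'] := eqVneq x w; first by rewrite E eqxx in wx.
  rewrite /c3 /upd /same (negPf xw') (negPf yw) andbF /= => cy.
  by move: yw; rewrite (hm x y w xy Hxw cy) ?eqxx // cs.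
exists c2; split.
- split=> // z.
  have [->|zu] := eqVneq z u; first exact: nice_leaf.
  have [->|zx] := eqVneq z x; first by apply: nice_nbr xu _ => //; apply: leq_trans du _.
  have [->|zw] := eqVneq z w.
    (* [w x] was the only edge of color 1 at [w], so [w] no longer sees color 1. *)
    apply/implyP => /andP[_ /sees1P[t wt ct]]; exfalso.
    have [E|tx] := eqVneq t x; first by rewrite E c2wx in ct.
    have Hwt : H w t by rewrite /H del_out.
    move: ct; rewrite /c2 upd_out // /c3 /upd /same (negPf tx) eqxx /= (negPf wx) /= => ct.
    by move: tx; rewrite (hm w t x Hwt Hwx ct cwx) eqxx.
  have [xz|nxz] := boolP (e x z).
    (* At most six edges lie around a neighbour [z] of degree 2, and if [z] sees color 1, two of
       them have it: [u x] and one at [z]. *)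
    have uz : u != z by rewrite eq_sym.
    have wz : w != z by rewrite eq_sym.
    have hx' := neighbours3_full ge xu xw xz uw uz wz.
    have zx' : e z x by rewrite (g_sym ge).
    apply/implyP => /andP[dz sz]; have [z' hz] := neighbours2 dz zx'.
    have zz' : e z' z by rewrite (g_sym ge) hz eqxx orbT.
    have [p [q hz']] := neighbours3 ge zz'.
    suff : nice e c2 z by rewrite /nice dz sz.
    apply: (nice_list (s := [:: Some i; c2 x z; c2 z z'; c2 z' p; c2 z' q])) => _ _.
    split.
      have : None \in [:: Some i; c2 x z; c2 z z'; c2 z' p; c2 z' q].
        have [t zt <-] := sees1P _ _ _ sz; move: zt; rewrite hz => /orP[] /eqP->.
          by rewrite c2s !inE eqxx ?orbT.
        by rewrite !inE eqxx ?orbT.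
      by move/count_color2.
    move=> y t; rewrite /near hz => /or3P[/eqP<-|/eqP->|/eqP->].
    - by rewrite hz => /orP[] /eqP->; rewrite 1?[c2 z x]c2s !inE eqxx ?orbT.
    - by rewrite hx' => /or3P[] /eqP->; rewrite ?c2xu 1?[c2 x w]c2s ?c2wx // !inE eqxx ?orbT.
    - by rewrite hz' => /or3P[] /eqP->; rewrite 1?[c2 z' z]c2s !inE eqxx ?orbT.
  (* Since [w] was spoiled, [nice_nbr] gives degree 3 to its neighbours. *)
  have [wz|nwz] := boolP (e w z).
    have [dz|dz] := leqP (degree e z) 2; last by rewrite /nice leqNgt dz.
    by case/negP: hw; apply: nice_nbr wz dz.
  apply: (nice_ext _ _ _ (hn z)).
  + by apply/leq_trans/degree_del.
  + by move=> t zt; rewrite c2out // /H del_out.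
  + move=> y t j; rewrite /near /H del_out // => nzy yt.
    have yx : y != x by apply: contraTneq nzy => ->; rewrite negb_or zx (g_sym ge).
    have yw : y != w by apply: contraTneq nzy => ->; rewrite negb_or zw (g_sym ge).
    have yu : y != u by apply: contraTneq nzy => ->; rewrite negb_or zu (g_sym ge) hu.
    by rewrite c2out // del_out.
- by left; rewrite /c2 upd_same.
- by move=> p q np nq; rewrite /c2 /c3 /upd /same (negPf np) (negPf nq) !andbF.
Qed.

Lemma degree_del_lt e p q : e p q -> degree (del e p q) p < degree e p.
Proof.
move=> pq; apply: proper_card; apply/properP; split.
  by apply/subsetP => w; rewrite !inE => /del_sub.
by exists q; rewrite inE // /del /= same_refl andbF.
Qed.

Lemma del_swap e p q x y : del e p q x y = del e q p x y.
Proof. by rewrite /del /= same_swap. Qed.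

Lemma degree_del_lt2 e p q : symmetric e -> e p q ->
  degree (del e p q) q < degree e q.
Proof.
move=> es pq; have -> : degree (del e p q) q = degree (del e q p) q.
  by apply: eq_card => w; rewrite !inE del_swap.
by apply: degree_del_lt; rewrite es.
Qed.

(** If [x] sees color 1 without [u x], where its degree is at most 2, niceness supplies a missed
    color for [pendant]; otherwise [u x] takes color 1. *)
Lemma leaf e u x : graph e -> e u x -> degree e u <= 1 ->
  colorable (del e u x) -> colorable e.
Proof.
move=> ge ux du [c gc].
have [sx|sx] := boolP (sees1 (del e u x) c x).
  have [cs hp /(_ x)] := gc; rewrite /nice sx andbT.
  have dx : degree (del e u x) x <= 2.
    rewrite -ltnS; apply: leq_trans (g_deg ge x).
    exact: degree_del_lt2 (g_sym ge) ux.
  rewrite dx /= => /existsP[i mi].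
  by have [c' [gc' _ _]] := pendant ge ux du gc sx mi; exists c'.
have [cs hp hn] := gc; have hu := neighbours1 du ux.
have us : forall x0 y, upd c u x None x0 y = upd c u x None y x0 by apply: upd_sym.
exists (upd c u x None); split=> //.
- apply: proper_upd => //; first exact: proper_pendant.
  split=> y xy; last by apply: contraNnot sx => E; apply/sees1P; exists y.
  by move: xy; rewrite /del /= hu => /andP[/eqP->]; rewrite same_refl.
- move=> z.
  have [->|zu] := eqVneq z u; first exact: nice_leaf.
  have [->|zx] := eqVneq z x.
    apply: (nice_nbr (a := u)) => //; first by rewrite (g_sym ge).
    exact: leq_trans du _.
  apply: (nice_ext _ _ _ (hn z)).
  + by apply/leq_trans/degree_del.
  + by move=> b zb; rewrite upd_out // del_out.
  + move=> a b j; rewrite /near del_out // /upd => na ab.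
    by case: ifPn => // nsame ->; rewrite /del /= ab.
Qed.

(** * Extending a coloring across a thread *)

Record thread e u v x y : Prop := Thread {
  th_uv : e u v; th_ux : e u x; th_vy : e v y;
  th_xv : x != v; th_yu : y != u;
  th_du : degree e u <= 2; th_dv : degree e v <= 2 }.

Lemma thread_sym e u v x y : graph e -> thread e u v x y -> thread e v u y x.
Proof. by move=> ge [? ? ? ? ? ? ?]; split=> //; rewrite (g_sym ge). Qed.

Lemma thread_nbrs e u v x y : thread e u v x y ->
  forall z, e u z = (z == v) || (z == x).
Proof.
by move=> [uv ux _ xv _ du _]; apply: neighbours2_full => //; rewrite eq_sym.
Qed.

(** Restoring [u v] can bring only [u x] and [v y] into conflict, hence the condition on their
    colors. Niceness near [u] and [v] is automatic, both having degree at most 2. *)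
Lemma close_set e u v x y c k : graph e -> thread e u v x y ->
  good (del e u v) c -> (c u x = c v y -> c u x = color1) ->
  free (del e u v) e c u v k -> good e (upd c u v k).
Proof.
move=> ge th [cs hp hn] hc hk.
have hu := thread_nbrs th; have hv := thread_nbrs (thread_sym ge th).
have [uv _ _ _ _ du dv] := th.
have hu' z : del e u v u z -> z = x.
  by rewrite /del /= hu => /andP[/orP[]/eqP-> //]; rewrite same_refl.
have hv' z : del e u v v z -> z = y.
  by rewrite /del /= hv => /andP[/orP[]/eqP-> //]; rewrite same_swap same_refl.
have us := upd_sym u v k cs.
split=> //.
- apply: proper_upd => //; apply: proper_near hp => i a b a' b' ab ab' ca ca'.
  rewrite /near; have [//|_ /= h] := eqVneq a a'.
  rewrite /del /= h; apply: contraT; rewrite negbK /same.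
  case/orP=> /andP[/eqP E1 /eqP E2]; subst a a'.
  + by move: ca ca' hc; rewrite (hu' _ ab) (hv' _ ab') => -> -> /(_ erefl).
  + by move: ca ca' hc; rewrite (hv' _ ab) (hu' _ ab') => -> -> /(_ erefl).
- have nu : nice e (upd c u v k) u by apply: nice_nbr uv dv.
  have nv : nice e (upd c u v k) v by apply: nice_nbr du => //; rewrite (g_sym ge).
  move=> z.
  have [h|h1] := boolP (near e u z); first exact: nice_near h.
  have [h|h2] := boolP (near e v z); first exact: nice_near h.
  apply: nice_upd_far => //.
  have zu : z != u by apply: contraNneq h1 => ->; rewrite /near eqxx.
  have zv : z != v by apply: contraNneq h2 => ->; rewrite /near eqxx.
  apply: (nice_ext _ _ _ (hn z)).
  + by apply/leq_trans/degree_del.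
  + by move=> t zt; rewrite del_out.
  + move=> a b j; rewrite /near del_out // => na ab.
    have au : a != u by apply: contraNneq h1 => <-; rewrite near_sym.
    have av : a != v by apply: contraNneq h2 => <-; rewrite near_sym.
    by rewrite del_out.
Qed.

Lemma close_color2 e u v x y c (s : seq color) : graph e -> thread e u v x y ->
  good (del e u v) c -> (c u x = c v y -> c u x = color1) ->
  count isSome s <= 4 ->
  (forall z, e x z -> c x z != None -> c x z \in s) ->
  (forall z, e y z -> c y z != None -> c y z \in s) -> colorable e.
Proof.
move=> ge th gc hc hs hx hy; have [i hi] := missing_color hs.
have cs := good_sym gc.
have hu := thread_nbrs th; have hv := thread_nbrs (thread_sym ge th).
have xu : e x u by rewrite (g_sym ge) hu eqxx orbT.
have yv : e y v by rewrite (g_sym ge) hv eqxx orbT.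
have hx' z : e x z -> c x z <> Some i.
  by move=> /hx h E; move: h hi; rewrite E => /(_ isT) ->.
have hy' z : e y z -> c y z <> Some i.
  by move=> /hy h E; move: h hi; rewrite E => /(_ isT) ->.
exists (upd c u v (Some i)); apply: (close_set ge th) => //.
have hu' b : del e u v u b -> c u b <> Some i.
  rewrite /del /= hu => /andP[/orP[]/eqP->]; first by rewrite same_refl.
  by rewrite cs => _; apply: hx'.
have hv' b : del e u v v b -> c v b <> Some i.
  rewrite /del /= hv => /andP[/orP[]/eqP->]; first by rewrite same_swap same_refl.
  by rewrite cs => _; apply: hy'.
move=> a b nab ab.
have : [|| a == u, a == v, a == x | a == y].
  move: nab; rewrite /near hu hv [u == a]eq_sym [v == a]eq_sym.
  by case: (a == u); case: (a == v); case: (a == x); case: (a == y).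
by case/or4P=> /eqP E; subst a; [apply: hu'|apply: hv'|apply/hx'/del_sub/ab|apply/hy'/del_sub/ab].
Qed.

(* If [y] sees color 1 off [v y], then at most four colors are forbidden for
   [u v]; otherwise [v y] may be recolored 1, with the same effect. *)
Lemma close_one e u v x y c : graph e -> thread e u v x y ->
  good (del e u v) c -> c u x = color1 -> colorable e.
Proof.
move=> ge th gc cu; have cs := good_sym gc.
have gH : graph (del e u v) by apply: graph_del.
have hu := thread_nbrs th; have hv := thread_nbrs (thread_sym ge th).
have xu : e x u by rewrite (g_sym ge) hu eqxx orbT.
have yv : e y v by rewrite (g_sym ge) hv eqxx orbT.
have [x1 [x2 hx]] := neighbours3 ge xu.
have [y1 [y2 hy]] := neighbours3 ge yv.
have both c' : good (del e u v) c' -> c' u x = None ->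
    None \in [:: c' y v; c' y y1; c' y y2] -> colorable e.
  move=> gc' cu' hin; have cs' := good_sym gc'.
  apply: (@close_color2 e u v x y c'
    ([:: c' x x1; c' x x2] ++ [:: c' y v; c' y y1; c' y y2])) => //.
  - rewrite count_cat; have := count_color2 hin.
    have := count_size isSome [:: c' x x1; c' x x2].
    by move=> h1 h2; apply: (@leq_add _ _ 2 2 h1 h2).
  - move=> z; rewrite hx => /or3P[] /eqP->; first by rewrite cs' cu'.
      by rewrite !inE eqxx ?orbT.
    by rewrite !inE eqxx ?orbT.
  - by move=> z; rewrite hy => /or3P[] /eqP->; rewrite mem_cat !inE eqxx ?orbT.
have [hin|hout] := boolP (None \in [:: c y v; c y y1; c y y2]); first exact: (both c).
have [uv ux vy xv yu du dv] := th.
have nuv : u != v := graph_neq ge uv.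
have nvy : v != y := graph_neq ge vy.
have Hvy : del e u v v y.
  by rewrite /del /= vy /same (negPf yu) [v == u]eq_sym (negPf nuv) andbF.
have dHv : degree (del e u v) v <= 1.
  rewrite -ltnS; apply: leq_trans dv.
  exact: degree_del_lt2 (g_sym ge) uv.
have hHv := neighbours1 dHv Hvy.
apply: (both (upd c v y None)).
- apply: recolor1 => //.
  + by move=> c' cs'; apply: nice_leaf.
  + move=> c' cs'; apply: (nice_nbr (a := v)) => //; first by rewrite (g_sym gH).
    exact: leq_trans dHv _.
  + by move=> z; rewrite hHv => ->.
  + move=> z /del_sub; rewrite hy => /or3P[] /eqP-> _ E; move: hout;
      by rewrite -E !inE eqxx ?orbT.
- by rewrite upd_out // eq_sym.
- by rewrite {1}/upd same_swap same_refl mem_head.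
Qed.

Lemma good_eq e d c : (forall x y, d x y = e x y) -> good e c -> good d c.
Proof.
move=> h [cs hp hn]; split=> //.
  apply: (@proper_near _ e).
    by move=> i x y z w _ _ _ _; rewrite /near h.
  by apply: proper_sub hp => x y; rewrite h.
move=> z; apply: (nice_ext _ _ _ (hn z)).
- by apply/leq_trans/degree_sub => w; rewrite h.
- by move=> b; rewrite h.
- by move=> a b i; rewrite /near !h.
Qed.

(** If neither edge has color 1, then color 1 is free for [u v]; otherwise [close_one] applies from
    the side colored 1. *)
Lemma close e u v x y c : graph e -> thread e u v x y ->
  good (del e u v) c -> (c u x = c v y -> c u x = color1) -> colorable e.
Proof.
move=> ge th gc hc.
case cu: (c u x) => [i|]; last exact: close_one th gc cu.
case cv: (c v y) => [j|]; last first.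
  apply: close_one (thread_sym ge th) _ cv => //.
  by apply: good_eq gc => a b; rewrite del_swap.
have hu := thread_nbrs th; have hv := thread_nbrs (thread_sym ge th).
exists (upd c u v None); apply: (close_set ge th) => //.
split=> z; rewrite /del /= ?hu ?hv => /andP[/orP[]/eqP->].
- by rewrite same_refl.
- by rewrite cu.
- by rewrite same_swap same_refl.
- by rewrite cv.
Qed.

Lemma thread_neq e u v x y : graph e -> thread e u v x y ->
  [/\ u != v, u != x & v != y].
Proof. by move=> ge [uv ux vy _ _ _ _]; split; apply: graph_neq ge _. Qed.

Lemma thread_del e u v x y : graph e -> thread e u v x y ->
  del e u v u x /\ degree (del e u v) u <= 1.
Proof.
move=> ge th; have [nuv nux nvy] := thread_neq ge th.
have [uv ux _ xv _ du _] := th; split.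
  by rewrite /del /= ux /same (negPf xv) (negPf nuv) andbF.
by rewrite -ltnS; apply: leq_trans du; apply: degree_del_lt.
Qed.

(** [pendant] restores [u x] with color 1 or [i]. As [x != y], the edge [v y] avoids [x] and keeps
    its color, which is not [i]; so [close] applies. *)
Lemma thread_pendant e u v x y c i : graph e -> thread e u v x y -> x != y ->
  good (del (del e u v) u x) c -> sees1 (del (del e u v) u x) c x ->
  misses (del (del e u v) u x) c x i -> c v y <> color2 i -> colorable e.
Proof.
move=> ge th xy gc sx mi cvy; have [Gux dGu] := thread_del ge th.
have [c' [gc' hux hout]] := pendant (graph_del u v ge) Gux dGu gc sx mi.
have [_ _ _ xv _ _ _] := th.
apply: (close ge th gc'); rewrite [c' v y]hout ?[_ == x]eq_sym // => E.
by case: hux => // E'; rewrite E' in E; case: cvy.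
Qed.

(** The obstruction to extending [c]: each conclusion in the second alternative would, if false,
    yield an extension. The clause ending in [good d c] is conditional because deleting [u x] may
    bring [x] down to degree 2. *)
Lemma stuck e u v x y c : graph e -> thread e u v x y -> good (del e u v) c ->
  let d := del (del e u v) u x in
  colorable e \/
  [/\ x != y, sees1 d c x, nice d c x -> good d c &
    exists2 k, c v y = color2 k & forall o, o != k -> ~~ misses d c x o].
Proof.
move=> ge th gc d; have [Gux dGu] := thread_del ge th.
have gG : graph (del e u v) by apply: graph_del.
have gd : graph d by apply: graph_del.
have [nuv nux nvy] := thread_neq ge th.
have [cs hp hn] := gc.
have [E|NE] := eqVneq (c u x) (c v y); last first.
  by left; apply: close ge th gc _ => E; rewrite E eqxx in NE.
case cu: (c u x) => [k|]; last by left; apply: close ge th gc _; rewrite cu.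
rewrite cu in E.
(* If [x] does not see color 1 in [d], then [u x] may take it in place of [k]. *)
have [sx|sx] := boolP (sees1 d c x); last first.
  left; apply: (close ge th (c := upd c u x None)); last by rewrite upd_same.
  apply: recolor1 => //.
  - by move=> c' cs'; apply: nice_leaf.
  - move=> c' cs'; apply: (nice_nbr (a := u)) => //; first by rewrite (g_sym gG).
    exact: leq_trans dGu _.
  - by move=> z; rewrite (neighbours1 dGu Gux) => ->.
  - move=> z xz zu; apply: contraNnot sx => cz; apply/sees1P; exists z => //.
    by rewrite /d /del /= in xz *; rewrite xz /same (negPf zu) [x == u]eq_sym (negPf nux) andbF.
have nyx : x != y.
  apply/negP => /eqP exy; have [_ hf] := hp.
  have xu : del e u v x u by rewrite (g_sym gG).
  have [_ _ vy _ yu _ _] := th.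
  have Gyv : del e u v y v.
    by rewrite (g_sym gG) /del /= vy /same (negPf yu) [v == u]eq_sym (negPf nuv) andbF.
  have := hf k x u y v xu Gyv; rewrite exy /near eqxx => /(_ isT).
  rewrite [c y u]cs -exy cu => /(_ erefl).
  rewrite [c x v]cs exy -E => /(_ erefl); rewrite /same [v == u]eq_sym (negPf nuv).
  by rewrite (negPf yu) andbF.
have du : degree d u <= 1 by apply: leq_trans dGu; apply: degree_del.
have gd' : nice d c x -> good d c.
  by move=> nx; apply: good_del => //; apply: nice_leaf.
have [hm|/forallPn[o]] := boolP [forall o, (o != k) ==> ~~ misses d c x o].
  right; split=> //; exists k => // o ok.
  by have /forallP/(_ o) := hm; rewrite ok.
(* A color [o] other than [k] missed at [x] makes [x] nice in [d] and serves to restore [u x]. *)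
rewrite negb_imply negbK => /andP[ok mo]; left.
apply: (thread_pendant ge th nyx _ sx mo).
  by apply: gd'; apply/implyP => _; apply/existsP; exists o.
by rewrite -E => -[E']; rewrite E' eqxx in ok.
Qed.


Lemma del_thread e u v x y a b : graph e -> thread e u v x y ->
  del (del e u v) u x a b = [&& e a b, a != u & b != u].
Proof.
move=> ge th; have hu := thread_nbrs th; have [nuv nux _] := thread_neq ge th.
rewrite /del /=; case ab: (e a b) => //=; rewrite /same.
have [E|au] := eqVneq a u.
  by move: ab; rewrite E hu (negPf nuv) (negPf nux); case: (b == v); case: (b == x).
have [E|bu] := eqVneq b u; last by rewrite !andbF.
by move: ab; rewrite E (g_sym ge) hu; case: (a == v); case: (a == x).
Qed.

(** Three type 2 colors around [x] and [k] make four, so a color other than [k] is missed, against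
    [stuck]. *)
Lemma stuck_list e u v x y c : graph e -> thread e u v x y ->
  good (del e u v) c ->
  (sees1 (del (del e u v) u x) c x -> exists s, count isSome s <= 3 /\
    forall a b, near e x a -> a != u -> e a b -> b != u -> c a b \in s) ->
  colorable e.
Proof.
move=> ge th gc hc.
have [//|[xy sx _ [k _ hk]]] := stuck ge th gc.
have [s [hs hin]] := hc sx.
have [|i] := @missing_color (Some k :: s); first by rewrite /= add1n ltnS.
rewrite inE negb_or => /andP[ik his].
have /missesP[] := hk i ik.
move=> a b; rewrite /near !(del_thread _ _ ge th) => nxa /and3P[ab au bu] E.
have : c a b \in s.
  by apply: hin => //; rewrite /near; case/orP: nxa => [->//|/and3P[-> _ _]]; rewrite orbT.
by rewrite E (negPf his).
Qed.

(** * Excluded ends of a thread *)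

(** Apart from [u x], only [x a] and at most two further edges at [a] lie on or next to [x]. *)
Lemma thread_end2 e u v x y : graph e -> thread e u v x y -> degree e x <= 2 ->
  colorable (del e u v) -> colorable e.
Proof.
move=> ge th dx [c gc]; have cs := good_sym gc.
have hu := thread_nbrs th.
have xu : e x u by rewrite (g_sym ge) hu eqxx orbT.
have [a hx] := neighbours2 dx xu.
have xa : e x a by rewrite hx eqxx orbT.
have ax : e a x by rewrite (g_sym ge).
have [a1 [a2 ha]] := neighbours3 ge ax.
apply: (stuck_list ge th gc) => _.
exists [:: c x a; c a a1; c a a2]; split; first exact: count_size.
move=> p q; rewrite /near hx => /or3P[/eqP<-|/eqP->|/eqP->] pu.
- by rewrite hx => /orP[] /eqP-> qu; [rewrite eqxx in qu | rewrite inE eqxx].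
- by rewrite eqxx in pu.
- by rewrite ha => /or3P[] /eqP-> _; rewrite 1?[c a x]cs !inE eqxx ?orbT.
Qed.

Lemma sees1_thread e u v x y c (s : seq V) : graph e -> thread e u v x y ->
  sees1 (del (del e u v) u x) c x ->
  (forall z, e x z = (z \in u :: s)) -> None \in map (c x) s.
Proof.
move=> ge th /sees1P[t]; rewrite (del_thread _ _ ge th) => /and3P[xt _ tu] ct hx.
by move: xt; rewrite hx inE (negPf tu) => /(map_f (c x)); rewrite ct.
Qed.

(** Without [u x] at most four edges remain around [x], and one of [x a], [x b] has color 1. *)
Lemma thread_end_nbrs2 e u v x y : graph e -> thread e u v x y ->
  (forall z, e x z -> degree e z <= 2) ->
  colorable (del e u v) -> colorable e.
Proof.
move=> ge th dx [c gc]; have cs := good_sym gc.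
have hu := thread_nbrs th.
have xu : e x u by rewrite (g_sym ge) hu eqxx orbT.
have [a [b hx]] := neighbours3 ge xu.
have xa : e x a by rewrite hx eqxx orbT.
have xb : e x b by rewrite hx eqxx !orbT.
have [a' ha] := neighbours2 (dx a xa) (etrans (g_sym ge a x) xa).
have [b' hb] := neighbours2 (dx b xb) (etrans (g_sym ge b x) xb).
apply: (stuck_list ge th gc) => sx.
exists [:: c x a; c x b; c a a'; c b b']; split.
  have hn : None \in map (c x) [:: a; b].
    by apply: (sees1_thread ge th sx) => z; rewrite hx !inE.
  have : None \in [:: c x a; c x b; c a a'; c b b'].
    by move: hn; rewrite !inE => /orP[]->; rewrite ?orbT.
  by move/count_color2.
move=> p q; rewrite /near hx => /or4P[/eqP<-|/eqP->|/eqP->|/eqP->] pu.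
- rewrite hx => /or3P[] /eqP-> qu; first by rewrite eqxx in qu.
    by rewrite !inE eqxx ?orbT.
  by rewrite !inE eqxx ?orbT.
- by rewrite eqxx in pu.
- by rewrite ha => /orP[] /eqP-> _; rewrite 1?[c a x]cs !inE eqxx ?orbT.
- by rewrite hb => /orP[] /eqP-> _; rewrite 1?[c b x]cs !inE eqxx ?orbT.
Qed.


(* Recoloring [a a2] frees its old color [o] at [x]; the new color exists since
   color 1 occurs, possibly after recoloring [a2 y2], among the edges at [y2]. *)
Lemma thread_end_thread e u v x y a a2 : graph e -> thread e u v x y ->
  e x a -> a != u -> degree e a <= 2 -> e a a2 -> a2 != x -> degree e a2 <= 2 ->
  colorable (del e u v) -> colorable e.
Proof.
move=> ge th xa au da aa2 a2x da2 cG; have [c gc] := cG.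
(* The previous two configurations give [x] degree 3 and a neighbour [b] of degree 3, which differs
   from [u] and [a]. *)
have [dx|dx] := leqP (degree e x) 2; first exact: thread_end2 ge th dx cG.
have [/forallP dn|/forallPn[b]] := boolP [forall z, e x z ==> (degree e z <= 2)].
  by apply: (thread_end_nbrs2 ge th) => // z xz; have := dn z; rewrite xz.
rewrite negb_imply -ltnNge => /andP[xb db].
have [nuv nux nvy] := thread_neq ge th.
have hu := thread_nbrs th; have hv := thread_nbrs (thread_sym ge th).
have [uv ux vy xv yu du dv] := th.
have [//|[xy sx gd' [k cvy hk]]] := stuck ge th gc.
set d := del (del e u v) u x in sx gd' hk.
have gd : graph d by do 2!apply: graph_del.
have dE p q : d p q = [&& e p q, p != u & q != u] by apply: del_thread th.
have xu : e x u by rewrite (g_sym ge) hu eqxx orbT.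
have ua : u != a by rewrite eq_sym.
have ub : u != b by apply: contraTneq db => <-; rewrite -leqNgt.
have ab : a != b by apply: contraTneq db => <-; rewrite -leqNgt.
have hx := neighbours3_full ge xu xa xb ua ub ab.
have [b1 [b2 hb]] := neighbours3 ge (etrans (g_sym ge b x) xb).
have xa2 : x != a2 by rewrite eq_sym.
have ax : e a x by rewrite (g_sym ge).
have ha := neighbours2_full da ax aa2 xa2.
have a2a : e a2 a by rewrite (g_sym ge).
have [y2 ha2] := neighbours2 da2 a2a.
have a2y2 : e a2 y2 by rewrite ha2 eqxx orbT.
have y2a2 : e y2 a2 by rewrite (g_sym ge).
have [z1 [z2 hy2]] := neighbours3 ge y2a2.
have av : a != v.
  by apply: contraTneq ax => ->; rewrite hv [x == u]eq_sym (negPf nux) (negPf xy).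
have a2u : a2 != u.
  by apply: contraTneq aa2 => ->; rewrite (g_sym ge) hu (negPf av) eq_sym (graph_neq ge xa).
have a2b : a2 != b by apply: contraTneq db => <-; rewrite -leqNgt.
have cs := good_sym gc.
have hn : None \in map (c x) [:: a; b].
  by apply: (sees1_thread ge th sx) => z; rewrite hx !inE.
have daa2 : d a a2 by rewrite dE aa2 au a2u.
have dda : degree d a <= 2 by apply: leq_trans da;
  apply: degree_sub => w; rewrite dE => /and3P[].
have dda2 : degree d a2 <= 2 by apply: leq_trans da2;
  apply: degree_sub => w; rewrite dE => /and3P[].
have dxa : d x a by rewrite dE xa au eq_sym nux.
have gc0 : good d c by apply: gd'; apply: nice_nbr dxa dda => //.
(* [o] avoids [k] and every edge of [d] around [x] except [a a2]; there is room because [x a] or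
   [x b] has color 1. As [x] must see [o], it is the color of [a a2]. *)
have [//||o ho] := @missing_color5 [:: c x a; c x b; c b b1; c b b2; Some k].
  by move: hn; rewrite !inE => /orP[]->; rewrite ?orbT.
move: ho; rewrite !inE !negb_or => /and5P[oxa oxb ob1 ob2 ok].
have nax : a != x by rewrite eq_sym (graph_neq ge xa).
have seen (P : V -> V -> Prop) : P x a -> P x b -> P a x -> P a a2 ->
    P b x -> P b b1 -> P b b2 -> forall p q, near d x p -> d p q -> P p q.
  move=> P1 P2 P3 P4 P5 P6 P7 p q; rewrite /near !dE hx => nxp /and3P[pq pu qu].
  have hp : [|| x == p, p == a | p == b].
    by move: nxp; rewrite (negPf pu) /= => /orP[->//|/andP[-> _]]; rewrite orbT.
  move: pq; case/or3P: hp => /eqP Ep; subst p.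
  - by rewrite hx (negPf qu) /= => /orP[] /eqP->.
  - by rewrite ha => /orP[] /eqP->.
  - by rewrite hb => /or3P[] /eqP->.
have caa2 : c a a2 = Some o.
  apply/eqP; apply: contraNT (hk o ok) => co; apply/missesP.
  apply: seen; apply/eqP; rewrite ?[c a x]cs ?[c b x]cs //;
    by rewrite eq_sym.
have a2v : a2 != v.
  apply/negP => /eqP E; move: aa2 caa2; rewrite E (g_sym ge) hv (negPf au) /=.
  by move=> /eqP->; rewrite cs cvy => -[E']; rewrite E' eqxx in ok.
have y2u : y2 != u.
  by apply: contraTneq a2y2 => ->; rewrite (g_sym ge) hu (negPf a2v) (negPf a2x).
have y2x : y2 != x.
  apply: contraTneq a2y2 => ->.
  by rewrite (g_sym ge) hx (negPf a2u) (negPf a2b) eq_sym (negPf (graph_neq ge aa2)).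
have da2a : d a2 a by rewrite (g_sym gd).
have dy2a2 : d y2 a2 by rewrite dE y2a2 y2u a2u.
(* The last two clauses record that [c1] creates no type 2 color and leaves the edges at [x]
   alone. *)
have [c1 [gc1 hn1 c1c c1x]] : exists c1, [/\ good d c1,
    None \in [:: c1 a2 y2; c1 y2 z1; c1 y2 z2],
    forall p q, c1 p q = c p q \/ c1 p q = None & forall q, c1 x q = c x q].
  have [h|h] := boolP (None \in [:: c a2 y2; c y2 z1; c y2 z2]).
    by exists c; split=> //; left.
  exists (upd c a2 y2 None); split.
  - apply: recolor1 => //.
    + by move=> c' cs'; apply: nice_nbr da2a dda.
    + by move=> c' cs'; apply: nice_nbr dy2a2 dda2.
    + move=> z; rewrite dE ha2 => /and3P[/orP[]/eqP-> _ _]; last by rewrite eqxx.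
      by rewrite cs caa2.
    + move=> z; rewrite dE hy2 => /and3P[/or3P[]/eqP-> _ _] nz E; last 2 first.
      * by rewrite !inE E eqxx !orbT in h.
      * by rewrite !inE E eqxx !orbT in h.
      by rewrite eqxx in nz.
  - by rewrite upd_same mem_head.
  - by move=> p q; rewrite /upd; case: ifP; [right | left].
  - by move=> q; rewrite upd_out // eq_sym.
have c1s := good_sym gc1.
(* The new color [m] of [a a2] must avoid [o], at most one type 2 color on [x a] and [x b], and at
   most two at [y2]. *)
have [|m] := @missing_color ([:: c x a; c x b] ++
    [:: c1 a2 y2; c1 y2 z1; c1 y2 z2] ++ [:: Some o]).
  have h1 : count isSome [:: c x a; c x b] <= 1 := count_color2 hn.
  have h2 : count isSome [:: c1 a2 y2; c1 y2 z1; c1 y2 z2] <= 2 := count_color2 hn1.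
  by rewrite !count_cat; apply: (@leq_add _ _ 1 3 h1); apply: (@leq_add _ _ 2 1 h2).
rewrite !mem_cat !inE !negb_or => /andP[/andP[mxa mxb] /andP[/and3P[my my1 my2] mo]].
pose c2 := upd c1 a a2 (Some m).
have gc2 : good d c2.
  apply: recolor2 => // p q nap /andP[pq nsame].
  have : [|| p == a, p == x, p == a2 | p == y2].
    move: nap; rewrite /near [a == p]eq_sym [a2 == p]eq_sym !dE ha ha2.
    by case: (p == a); case: (p == x); case: (p == a2); case: (p == y2).
  move: pq; rewrite dE => /and3P[pq pu qu].
  move=> Ep E; suff : Some m \in [:: c x a; c x b; c1 a2 y2; c1 y2 z1; c1 y2 z2].
    by rewrite !inE (negPf mxa) (negPf mxb) (negPf my) (negPf my1) (negPf my2).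
  rewrite -{}E; case/or4P: Ep => /eqP Ep; subst p; move: pq nsame.
  - rewrite ha => /orP[] /eqP->; last by rewrite same_refl.
    by rewrite c1s c1x !inE eqxx.
  - rewrite hx (negPf qu) /= => /orP[] /eqP->; by rewrite c1x !inE eqxx ?orbT.
  - rewrite ha2 => /orP[] /eqP->; first by rewrite same_swap same_refl.
    by rewrite !inE eqxx ?orbT.
  - rewrite hy2 => /or3P[] /eqP->; rewrite 1?[c1 y2 a2]c1s !inE eqxx ?orbT //.
have c2s := good_sym gc2.
have c2x q : c2 x q = c x q by rewrite /c2 upd_out ?c1x // eq_sym.
have c2b q : Some o != c b q -> c2 b q <> Some o.
  move=> h; have ba : b != a by rewrite eq_sym.
  have ba2 : b != a2 by rewrite eq_sym.
  rewrite /c2 upd_out //; case: (c1c b q) => -> // E.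
  by rewrite E eqxx in h.
(* [o] has disappeared around [x] in [d] and is not the color of [v y], so it can restore [u x]. *)
apply: (thread_pendant ge th xy gc2 (i := o)).
- by have /sees1P[t dt ct] := sx; apply/sees1P; exists t; rewrite ?c2x.
- apply/missesP; apply: seen; rewrite ?[c2 a x]c2s ?[c2 b x]c2s ?c2x.
  + by apply/eqP; rewrite eq_sym.
  + by apply/eqP; rewrite eq_sym.
  + by apply/eqP; rewrite eq_sym.
  + by rewrite /c2 upd_same; apply/eqP.
  + by apply/eqP; rewrite eq_sym.
  + exact: c2b.
  + exact: c2b.
- have va : v != a by rewrite eq_sym.
  have va2 : v != a2 by rewrite eq_sym.
  rewrite /c2 upd_out //; case: (c1c v y) => -> //; rewrite cvy => -[E].
  by rewrite E eqxx in ok.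
Qed.

(** * Discharging *)

(** Every nonempty induced subgraph has average degree below 12/5, with denominators cleared. *)
Definition sparse e := forall S : {set V}, S != set0 ->
  5 * \sum_(v in S) #|[set w in S | e v w]| < 12 * #|S|.

Lemma sparse_sub e d : (forall x y, d x y -> e x y) -> sparse e -> sparse d.
Proof.
move=> h sp S /sp; apply: leq_ltn_trans; rewrite leq_mul2l /=.
apply: leq_sum => v _; apply/subset_leq_card/subsetP => w.
by rewrite !inE => /andP[-> /h].
Qed.

Lemma other_neighbour e v u : 1 < degree e v -> exists2 y, e v y & y != u.
Proof.
rewrite /degree (cardsD1 u) => h.
have : 0 < #|[set w | e v w] :\ u|.
  by move: h; case: (u \in _); case: #|_|.
by case/card_gt0P => y; rewrite !inE => /andP[yu vy]; exists y.
Qed.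

Lemma discharging e : graph e -> sparse e ->
  (forall u x, e u x -> 1 < degree e u) ->
  (forall u v x y, thread e u v x y ->
    [/\ 2 < degree e x, exists2 b, e x b & 2 < degree e b &
      forall a a2, e x a -> a != u -> degree e a <= 2 -> e a a2 -> a2 != x ->
        2 < degree e a2]) ->
  forall a b, e a b = false.
Proof.
move=> ge sp hleaf hth a0 b0; apply/negP => ab0.
have deg_cases x y : e x y -> degree e x = 2 \/ degree e x = 3.
  by move=> /hleaf; have := g_deg ge x; case: (degree e x) => [|[|[|[|]]]]; auto.
(* [f] and [g] are the positive and negative parts of [5 deg - 12] in degrees 3 and 2. *)
pose f x := if degree e x == 3 then 3 else 0.
pose g x := if degree e x == 2 then 2 else 0.
pose light u := [exists v, e u v && (degree e v == 2)].
pose charge x u := if [&& e x u, degree e x == 3 & degree e u == 2]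
  then (if light u then 2 else 1) else 0.
have thread_at u x : e x u -> degree e x == 3 -> degree e u == 2 -> light u ->
    exists v y, thread e u v x y.
  move=> xu /eqP dx /eqP du /existsP[v /andP[uv /eqP dv]].
  have [|y vy yu] := @other_neighbour e v u; first by rewrite dv.
  exists v, y; split; rewrite ?du ?dv //; first by rewrite (g_sym ge).
  by apply: contra_eq_neq dv => <-; rewrite dx.
(* A vertex of degree 3 sends either 2 to a thread, nothing to [b] and at most 1 to its third
   neighbour, or at most 1 to each neighbour. *)
have hA x : \sum_u charge x u <= f x.
  rewrite /f; have [/eqP dx|dx] := boolP (degree e x == 3); last first.
    by rewrite big1 // => u _; rewrite /charge (negPf dx) andbF.
  have [/existsP[u0 /and3P[xu0 du0 lu0]]|hno] :=
      boolP [exists u, [&& e x u, degree e u == 2 & light u]].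
    have [|v [y th]] := thread_at u0 x xu0 _ du0 lu0; first by rewrite dx.
    have [_ [b xb db] hR] := hth _ _ _ _ th.
    rewrite (bigD1 u0) //= (leq_add (n1 := 2) (n2 := 1)) //.
      by rewrite /charge; case: ifP => // _; case: ifP.
    pose A := [set w | e x w] :\ u0 :\ b.
    apply: (@leq_trans #|A|).
      rewrite -sum1_card [leqRHS]big_mkcond [leqLHS]big_mkcond; apply: leq_sum => u _.
      case: ifP => // uu0; rewrite /charge; case: ifP => // /and3P[xu _ /eqP du].
      rewrite !inE xu uu0 andbT /=.
      have -> : u != b by apply: contraTneq db => <-; rewrite du.
      case: ifP => // /existsP[w /andP[uw /eqP dw]].
      have wx : w != x by apply: contra_eq_neq dw => ->; rewrite dx.
      by have := hR u w xu uu0; rewrite du dw => /(_ isT uw wx).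
    have : #|[set w | e x w]| = 3 by [].
    rewrite (cardsD1 u0) inE xu0 (cardsD1 b) !inE xb andbT.
    have -> : b != u0 by apply: contraTneq db => ->; rewrite (eqP du0).
    by rewrite -/A !add1n => -[->].
  apply: (@leq_trans #|[set w | e x w]|); last by rewrite -/(degree e x) dx.
  rewrite -sum1_card [leqRHS]big_mkcond; apply: leq_sum => u _.
  rewrite inE /charge; case: ifP => // /and3P[xu _ du]; rewrite xu.
  case: ifP => // lu; case/existsP: hno; exists u; by rewrite xu du lu.
(* A vertex of degree 2 gets 2 from the end of its thread or, when not on a thread, 1 from each of
   its two neighbours. *)
have hB u : g u <= \sum_x charge x u.
  rewrite /g; case: ifP => // du.
  have [|a ua _] := @other_neighbour e u u; first by rewrite (eqP du).
  have [lu|nlu] := boolP (light u).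
    have [v /andP[uv dv]] := existsP lu.
    have [|x ux xv] := @other_neighbour e u v; first by rewrite (eqP du).
    have [|y vy yu] := @other_neighbour e v u; first by rewrite (eqP dv).
    have th : thread e u v x y by split; rewrite ?(eqP du) ?(eqP dv).
    have [dx _ _] := hth _ _ _ _ th.
    have xu : e x u by rewrite (g_sym ge).
    have dx3 : degree e x == 3 by rewrite eqn_leq dx g_deg.
    by rewrite (bigD1 x) //= {1}/charge xu dx3 du lu leq_addr.
  have deg3 x : e u x -> charge x u = 1.
    move=> ux; have xu : e x u by rewrite (g_sym ge).
    rewrite /charge xu du (negPf nlu).
    have [E|->//] := deg_cases _ _ xu.
    by case/existsP: nlu; exists x; rewrite ux E.
  have [|b ub ba] := @other_neighbour e u a; first by rewrite (eqP du).
  by rewrite (bigD1 a) //= (bigD1 b) //= !deg3.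
(* Isolated vertices are left out: [5 deg - 12] is negative there and nothing compensates for it. *)
pose S := [set v | 0 < degree e v].
have inS x y : e x y -> x \in S by move=> /hleaf h; rewrite inE; apply: ltnW.
have hS : \sum_(v in S) #|[set w in S | e v w]| = \sum_v degree e v.
  rewrite big_mkcond; apply: eq_bigr => v _.
  rewrite inE; case: posnP => [//|_]; apply: eq_card => w; rewrite !inE.
  case vw: (e v w); rewrite ?andbF // andbT.
  by have := inS w v; rewrite inE (g_sym ge) => /(_ vw).
have hpt v : 5 * degree e v + g v = 12 * (v \in S) + f v.
  rewrite inE /f /g; case: (posnP (degree e v)) => [->//|].
  move=> /card_gt0P[w]; rewrite inE => vw.
  by case: (deg_cases _ _ vw) => ->.
have hsum : 5 * \sum_v degree e v + \sum_v g v = 12 * #|S| + \sum_v f v.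
  rewrite -sum1_card [in RHS]big_mkcond !big_distrr /= -!big_split /=.
  apply: eq_bigr => v _; rewrite hpt; by case: (v \in S).
have hfg : \sum_v g v <= \sum_v f v.
  apply: (@leq_trans (\sum_u \sum_x charge x u)); first by apply: leq_sum => u _.
  rewrite exchange_big /=; by apply: leq_sum => x _; apply: hA.
have := sp S; rewrite hS => /(_ _).
have -> : S != set0 by apply/set0Pn; exists a0; apply: inS ab0.
move/(_ isT); lia.
Qed.

(** * Minimal counterexample *)

(** Induction on the number of ordered adjacent pairs. Sparseness passes to subgraphs, so in a
    minimal counterexample the reducible configurations give the premises of [discharging]; it then
    has no edge and is trivially colorable. *)
Lemma sparse_colorable e : graph e -> sparse e -> colorable e.
Proof.
have [n] := ubnP #|[set p : V * V | e p.1 p.2]|.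
elim: n e => // n IH e hn ge sp.
have rem p q : e p q -> colorable (del e p q).
  move=> pq; apply: IH; last 2 first.
  - exact: graph_del.
  - by apply: sparse_sub sp => x y /del_sub.
  rewrite -ltnS; apply: leq_trans hn; rewrite ltnS.
  apply: proper_card; apply/properP; split.
    by apply/subsetP => w; rewrite !inE => /del_sub.
  by exists (p, q); rewrite inE // /del /= same_refl andbF.
apply: NNPP => nc.
have noedge : forall a b, e a b = false.
  apply: discharging => // [u x ux|u v x y th].
    by rewrite ltnNge; apply/negP => du; apply: nc; apply: leaf ux du (rem u x ux).
  have cG := rem u v (th_uv th).
  have dx : 2 < degree e x.
    by rewrite ltnNge; apply/negP => dx; apply: nc; apply: (thread_end2 ge th).
  split=> // [|a a2 xa au da aa2 a2x].
    have [/existsP[b /andP[xb db]]|hno] := boolP [exists b, e x b && (2 < degree e b)].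
      by exists b.
    case: nc; apply: (thread_end_nbrs2 ge th) => // z xz; rewrite leqNgt.
    by apply: contra hno => dz; apply/existsP; exists z; rewrite xz.
  rewrite ltnNge; apply/negP => da2; apply: nc.
  exact: (thread_end_thread ge th xa au da aa2).
apply: nc; exists (fun _ _ => None); split=> //.
- by split=> [x y z|i x y z w]; rewrite noedge.
- by move=> z; apply/implyP => /andP[_ /sees1P[t]]; rewrite noedge.
Qed.

End Graphs.

(** * Edge sets, distances and the maximum average degree *)

Import GRing.Theory Num.Theory.

Section Walks.

Variables (T : finType) (r : rel T).

(** A length returned by [dist] is that of an actual walk, hence at least [k] here; infinite
    distance qualifies as well. *)
Lemma dist_at_leastI k x y :
  (forall n, n < k -> ~~ walk_of_length r x y n) -> dist_at_least r k x y.
Proof.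
move=> h; rewrite /dist_at_least /dist; case: ifP => // hn.
set n := find _ _ in hn *; rewrite leqNgt; apply/negP => /h/negP; apply.
have := @nth_find _ 0 (walk_of_length r x y) (iota 0 #|T|).
by rewrite has_find size_iota -/n nth_iota // => /(_ hn).
Qed.

Lemma dist_at_mostE k x y :
  dist_at_most r k x y -> exists2 n, n <= k & walk_of_length r x y n.
Proof.
rewrite /dist_at_most /dist; case: ifP => // hn.
set n := find _ _ in hn * => nk; exists n => //.
have := @nth_find _ 0 (walk_of_length r x y) (iota 0 #|T|).
by rewrite has_find size_iota -/n nth_iota // => /(_ hn).
Qed.

Lemma walk0 x y : walk_of_length r x y 0 -> x = y.
Proof. by case/existsP => p; rewrite (tuple0 p) => /eqP. Qed.

Lemma walk1 x y : walk_of_length r x y 1 -> r x y.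
Proof.
by case/existsP => -[[|a [|//]] //= _]; rewrite andbT => /andP[h /eqP<-].
Qed.

Lemma walk2 x y :
  walk_of_length r x y 2 -> exists2 z, r x z & r z y.
Proof.
case/existsP => -[[|a [|b [|//]]] //= _].
by rewrite andbT => /andP[/andP[h1 h2] /eqP<-]; exists a.
Qed.

End Walks.

Section EdgeSets.

Variables (V : finType) (adj : rel V).
Hypotheses (adj_sym : symmetric adj) (adj_irr : irreflexive adj).

Lemma dist_at_most1 x y : dist_at_most adj 1 x y -> near adj x y.
Proof.
case/dist_at_mostE => -[_ /walk0->|[_ /walk1 h|//]]; first by rewrite /near eqxx.
by rewrite /near h orbT.
Qed.

Lemma same_set2 (p q x y : V) : [set p; q] = [set x; y] -> same p q x y.
Proof.
move=> /setP E; have := E p; have := E q; have := E x; have := E y.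
rewrite !inE !eqxx ?orbT /same.
by rewrite [p == x]eq_sym [p == y]eq_sym [q == x]eq_sym [q == y]eq_sym;
  case: (x == p); case: (x == q); case: (y == p); case: (y == q).
Qed.

Lemma edge_at f t : f \in edges adj -> t \in f -> exists2 s, adj t s & f = [set t; s].
Proof.
rewrite inE => /existsP[x /existsP[y /andP[xy /eqP->]]].
rewrite !inE => /orP[]/eqP->; first by exists y.
by exists x; [rewrite adj_sym | rewrite setUC].
Qed.

Lemma mem_edge x y : adj x y -> [set x; y] \in edges adj.
Proof.
move=> xy; rewrite inE; apply/existsP; exists x; apply/existsP; exists y.
by rewrite xy eqxx.
Qed.

Lemma good_coloring_of (c : V -> V -> color) :
  good adj c -> exists C, good_coloring adj C.
Proof.
move=> [cs [hm hf] hn].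
(* [C] reads the color off any ordered pair representing the edge; symmetry of [c] makes the choice
   immaterial. Other sets get color 1 by default. *)
pose C (f : {set V}) : color :=
  if [pick p : V * V | adj p.1 p.2 && (f == [set p.1; p.2])] is Some p
  then c p.1 p.2 else None.
have CE x y : adj x y -> C [set x; y] = c x y.
  move=> xy; rewrite /C; case: pickP => [[p q] /= /andP[_ /eqP E]|/(_ (x, y))].
    by have := same_set2 E; rewrite /same => /orP[]/andP[/eqP-> /eqP->].
  by rewrite /= xy eqxx.
exists C; split; last first.
  move=> u du [f [fe uf Cf]] hall.
  have [s us E] := edge_at fe uf; rewrite E CE // in Cf.
  have := hn u; rewrite /nice du /=.
  have -> : sees1 adj c u by apply/sees1P; exists s.
  move=> /existsP[i /missesP mi].
  have [u1 [u2 [u12]]] := hall i; rewrite CE // => E12.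
  case/orP=> /dist_at_most1 nr; first exact: mi nr u12 E12.
  by apply: (mi u2 u1 nr); rewrite 1?cs 1?adj_sym.
have adjacent (f g : {set V}) : line_adj adj f g ->
    exists t s s', [/\ adj t s, adj t s', f = [set t; s] & g = [set t; s']].
  case/and4P=> fe ge _ /set0Pn[t]; rewrite inE => /andP[tf tg].
  have [s ts Ef] := edge_at fe tf; have [s' ts' Eg] := edge_at ge tg.
  by exists t, s, s'.
have clash i t s t' s' : adj t s -> adj t' s' -> near adj t t' ->
    C [set t; s] = Some i -> C [set t'; s'] = Some i -> [set t; s] = [set t'; s'].
  move=> ts ts' n; rewrite !CE // => c1 c2.
  have := hf i t s t' s' ts ts' n c1 c2; rewrite /same.
  by case/orP=> /andP[/eqP-> /eqP->] //; rewrite setUC.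
split.
- move=> f g fe ge fg cf cg; apply: dist_at_leastI => -[_|[_|//]].
    by apply: contra fg => /walk0->.
  apply: contra fg => /walk1 /adjacent[t [s [s' [ts ts' Ef Eg]]]].
  by subst f g; rewrite !CE // in cf cg; rewrite (hm t s s').
- move=> i f g fe ge fg cf cg; apply: dist_at_leastI => -[_|[_|[_|//]]].
  + by apply: contra fg => /walk0->.
  + apply: contra fg => /walk1 /adjacent[t [s [s' [ts ts' Ef Eg]]]].
    by subst f g; apply/eqP; apply: (clash i) => //; rewrite /near eqxx.
  (* The middle edge [h] meets [f] in [t] and [g] in [t'], so these vertices are equal or
     adjacent. *)
  + apply: contra fg => /walk2[h /adjacent[t [s [s' [ts ts' Ef Eh]]]]].
    case/adjacent=> [t' [r [r' [tr tr' Eh' Eg]]]]; subst f g.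
    apply/eqP; apply: (clash i) => //.
    have : t' \in h by rewrite Eh' !inE eqxx.
    by rewrite Eh !inE /near [t == t']eq_sym => /orP[->//|/eqP->]; rewrite ts' orbT.
Qed.

(** * From maximum average degree to sparseness *)

Lemma card_edge f : f \in edges adj -> #|f| <= 2.
Proof. by rewrite inE => /existsP[x /existsP[y /andP[_ /eqP->]]]; rewrite cards2; case: eqP. Qed.

(** Double counting of incidences: distinct neighbours of [v] in [S] give distinct edges at [v], and
    an edge has at most two ends. *)
Lemma sum_inner_degree (S : {set V}) :
  \sum_(v in S) #|[set w in S | adj v w]| <= 2 * #|[set f in edges adj | f \subset S]|.
Proof.
set E := [set f in _ | _].
apply: (@leq_trans (\sum_(v in S) \sum_(f in E) (v \in f))).
  apply: leq_sum => v vS; rewrite -big_mkcondr /= sum1_card -(card_in_imset (f := fun w => [set v; w])).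
    apply/subset_leq_card/subsetP => f /imsetP[w]; rewrite inE => /andP[wS vw] ->.
    rewrite unfold_in /= set21 andbT inE mem_edge //=.
    by apply/subsetP => z; rewrite !inE => /orP[]/eqP->.
  move=> w1 w2; rewrite !inE => /andP[_ v1] /andP[_ v2] /same_set2.
  have n1 : v != w1 by apply: contraTneq v1 => ->; rewrite adj_irr.
  by rewrite /same eqxx (negPf n1) orbF => /eqP->.
rewrite exchange_big /= mulnC -sum_nat_const; apply: leq_sum => f.
rewrite inE => /andP[fe fS]; apply: leq_trans (card_edge fe).
rewrite -sum1_card -big_mkcondr /=.
by rewrite (eq_bigl (fun v => v \in f)) // => v; rewrite andb_idl // => /(subsetP fS).
Qed.

(** The subgraph induced on [S] takes part in the maximum defining [mad]; clearing denominators
    gives the bound. *)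
Lemma mad_sparse : (mad adj < 12%:R / 5%:R)%R -> sparse adj.
Proof.
move=> hmad S S0.
pose E := [set f in edges adj | f \subset S].
have hsub : nonempty_subgraph adj (S, E).
  apply/and3P; split => //=; first by apply/subsetP => f; rewrite inE => /andP[].
  by apply/forallP => f; apply/implyP; rewrite inE => /andP[].
have hle : ((2 * #|E|)%:R / #|S|%:R <= mad adj)%R.
  exact: (Order.TotalTheory.le_bigmax_cond _
    (fun H : {set V} * {set {set V}} => ((2 * #|H.2|)%:R / #|H.1|%:R)%R) hsub).
have hlt := Order.POrderTheory.le_lt_trans hle hmad.
have S_gt0 : 0 < #|S| by rewrite card_gt0.
move: hlt; rewrite ltr_pdivrMr ?ltr0n // mulrAC ltr_pdivlMr ?ltr0n // -!natrM ltr_nat => hlt.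
apply: leq_ltn_trans hlt; rewrite mulnC leq_mul2r /=; exact: sum_inner_degree.
Qed.

End EdgeSets.

Theorem theorem3p1 (V : finType) (adj : rel V)
    (adj_sym : symmetric adj) (adj_irr : irreflexive adj)
    (G_subcubic : subcubic adj)
    (G_mad : (mad adj < 12%:R / 5%:R)%R) :
  exists c : {set V} -> color, good_coloring adj c.
Proof.
have ge : graph adj.
  by split=> // v; apply: leq_trans G_subcubic; apply: leq_bigmax.
have [c gc] := sparse_colorable ge (mad_sparse adj_irr G_mad).
by apply: good_coloring_of gc.
Qed.
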